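(* Let $G$ be a connected deformed cylinder each of whose slices is connected as well. Assume that there exists some $N\in\mathbb{N}$ such that there are both infinitely many positive levels and infinitely many negative levels whose slices have the following property: for each of these slices there are no more than $N$ edges of $G$ touching it or contained in it. Let the couplings on the edges of $G$ be i.i.d. with a symmetric continuous distribution whose support is all of $\mathbb{R}$. Then, for almost every realization of the couplings, $G$ has exactly one ground state pair (GSP).
   Context: A deformed cylinder is a graph $G$ with vertex set $\bigcup_{h\in\mathbb{Z}}\{h\}\times V_h$ such that whenever there is an edge between $(h,v)$ and $(h',v')$ then either $h=h'$ or $|h-h'|=1$. The $h$-th slice is the subgraph of $G$ over the vertices with first coordinate $h$; $h$ is called the level of these vertices and of the slice. Given couplings $\mathcal{J}=(J_{xy})$ on the edges of $G$, a configuration $\sigma\in\{-1,1\}^{V(G)}$ is a ground state if for every finite set $C$ of vertices $-\sum_{\langle x,y\rangle\in\partial C}J_{xy}\sigma_x\sigma_y\le 0$, where $\partial C$ is the set of edges connecting $C$ to its complement (i.e. the energy $-\sum J_{xy}\sigma_x\sigma_y$ cannot be lowered by flipping finitely many spins). If $\sigma$ is a ground state so is $-\sigma$; the pair $\{\sigma,-\sigma\}$ is a ground state pair (GSP).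
   Formalization: The slices of the deformed cylinder are assumed to have finite vertex sets V_h; without this the claim fails, e.g. when slice 0 is an infinite binary tree and every other slice is a single vertex on a line through the root. *)

(* Defs.v *)
From HB Require Import structures.
From mathcomp Require Import all_boot all_order all_algebra finmap.
From mathcomp Require Import all_classical all_reals all_analysis.

Set Implicit Arguments.
Unset Strict Implicit.
Unset Printing Implicit Defensive.

Import Order.TTheory GRing.Theory Num.Theory.
Import numFieldNormedType.Exports.

Local Open Scope classical_set_scope.
Local Open Scope ring_scope.

(* Cross-sections are finite, so the graph is locally finite and the boundary
   energy of a finite vertex set is a finite sum. *)
Record deformed_cylinder := DeformedCylinder {
  cross_section : int -> finType;
  adj : rel {h : int & cross_section h};
  adj_sym : symmetric adj;
  adj_irr : irreflexive adj;
  adj_level : forall x y, adj x y ->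
    tag x = tag y \/ `|tag x - tag y| = 1 }.

Section Graph.
Variable G : deformed_cylinder.

Definition vertex : countType := {h : int & cross_section G h}.

Definition level (x : vertex) : int := tag x.

Definition slice (h : int) : set vertex := [set x | level x = h].

Definition edges : set {fset vertex} :=
  [set e | exists x y : vertex, adj x y /\ e = [fset x; y]%fset].

(* Connectedness of the subgraph induced on [A]; the empty graph is not
   connected. *)
Definition connected_on (A : set vertex) : Prop :=
  A !=set0 /\
  forall x y : vertex, A x -> A y ->
    exists p : seq vertex,
      [/\ path (@adj G) x p, last x p = y & forall z, z \in p -> A z].

Definition edges_touching (h : int) : set {fset vertex} :=
  [set e | edges e /\ exists2 x : vertex, x \in e & slice h x].

Definition thin_slice (N : nat) (h : int) : Prop :=
  (edges_touching h #<= `I_N)%card.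

Definition edge_boundary (C : {fset vertex}) : set {fset vertex} :=
  [set e | exists x y : vertex,
    [/\ adj x y, x \in C, y \notin C & e = [fset x; y]%fset]].

(* The finitely supported sum in [ground_state] is thus a genuine sum. *)
Lemma finite_edge_boundary (C : {fset vertex}) : finite_set (edge_boundary C).
Proof.
have fin_slice h : finite_set (slice h).
  apply: (sub_finite_set (B := Tagged (cross_section G) @` [set: cross_section G h])).
    by move=> [k v] /= <-; exists v.
  exact: finite_image.
pose near x := slice (level x) `|` (slice (level x + 1) `|` slice (level x - 1)).
apply: (sub_finite_set (B := \bigcup_(x in [set` C])
  (fun y => [fset x; y]%fset) @` near x)); last first.
  by apply: bigcup_finite => // x _; apply: finite_image; rewrite !finite_setU.
move=> e [x [y [xy xC _ ->]]]; exists x => //; exists y => //.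
case: (adj_level xy) => [lxy|]; first by left.
rewrite /near /slice /level /= => lxy; right.
have [d0|d0] := leP 0 (tag x - tag y); [right|left].
  by move: lxy; rewrite ger0_norm// => <-; rewrite opprB addrCA subrr addr0.
by move: lxy; rewrite ltr0_norm// => <-; rewrite opprB addrCA subrr addr0.
Qed.

Section GroundStates.
Variable R : realType.

Definition spin_configuration (s : vertex -> R) : Prop :=
  forall x, s x = 1 \/ s x = -1.

(* For an edge [e] = {x, y} the product over [e] is [s x * s y].  Only the
   values of [J] on [edges] matter. *)
Definition ground_state (J : {fset vertex} -> R) (s : vertex -> R) : Prop :=
  spin_configuration s /\
  forall C : {fset vertex},
    - \sum_(e \in edge_boundary C) (J e * \prod_(x <- e) s x) <= 0.

Definition ground_state_pair (J : {fset vertex} -> R)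
    (p : set (vertex -> R)) : Prop :=
  exists2 s, ground_state J s & p = [set s; \- s].

End GroundStates.
End Graph.

Section Couplings.
Context (R : realType).

Definition symmetric_law (mu : set R -> \bar R) : Prop :=
  forall A : set R, measurable A -> mu (-%R @` A) = mu A.

Definition continuous_law (mu : set R -> \bar R) : Prop :=
  forall x, mu [set x] = 0%E.

Definition law_support (mu : set R -> \bar R) : set R :=
  [set x : R | forall U : set R, open U -> U x -> (0 < mu U)%E].

Context (d : measure_display) (T : measurableType d) (P : probability T R)
  (I : choiceType).

Definition mutually_independent (D : set I) (X : I -> {RV P >-> R}) : Prop :=
  forall (F : {fset I}) (B : I -> set R),
    [set` F] `<=` D -> (forall i, measurable (B i)) ->
    P (\bigcap_(i in [set` F]) (X i @^-1` B i)) =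
    (\prod_(i <- F) P (X i @^-1` B i))%E.

Definition iid (D : set I) (X : I -> {RV P >-> R}) (mu : set R -> \bar R)
    : Prop :=
  mutually_independent D X /\
  forall i, D i -> forall A : set R, measurable A -> distribution P (X i) A = mu A.

End Couplings.

(* Main.v *)
(* Call a thin slice good when each bond inside it exceeds 1 and the bonds leaving
   it are so weak that all of them together weigh at most 1/(n+1). The probability
   that a thin slice is good is bounded below by a constant depending on N and n
   only, and slices at distance at least 2 are independent, so almost surely there
   are, for each n, good slices arbitrarily far in both directions.
   A ground state is constant on a good slice; hence the ratio of two ground states
   s and t is constant there too. Between two good slices the wall where s/t changes
   sign is finite. Flipping all spins beyond the wall, up to a far good slice with
   nearly zero outgoing bonds, shows that the energy of the wall is nonnegative for
   both s and t; but these energies are opposite, so they vanish. Almost surely no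
   nonempty finite signed sum of couplings vanishes, so there is no wall.
   Existence is compactness, through an ultrafilter limit of finite-volume ground
   states. *)
Require Import Defs.
From mathcomp Require Import all_boot all_order all_algebra finmap.
From mathcomp Require Import all_classical all_reals all_analysis.
From mathcomp Require Import measurable_realfun.
From mathcomp Require Import zify lra.

Import Order.TTheory GRing.Theory Num.Theory.
Import numFieldNormedType.Exports.

Local Open Scope classical_set_scope.
Local Open Scope ring_scope.

Set Implicit Arguments.
Unset Strict Implicit.
Unset Printing Implicit Defensive.

(** * Levels, and boundaries of arbitrary vertex sets *)

Section Cylinder.
Variable G : deformed_cylinder.
Local Notation V := (vertex G).
Local Notation E := {fset V}.
Implicit Types (x y : V) (A B : set V) (h : int).

Lemma adj_level_le x y : adj x y -> level y <= level x + 1.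
Proof.
rewrite /level => /adj_level[->|xy]; first by rewrite lerDl.
by rewrite -lerBlDl -xy distrC ler_norm.
Qed.

Lemma finite_levels (a b : int) : finite_set [set x : V | a <= level x <= b].
Proof.
have fin_slice h : finite_set (@slice G h).
  apply: (sub_finite_set (B := Tagged (cross_section G) @` [set: cross_section G h])).
    by move=> [k v] /= <-; exists v.
  exact: finite_image.
apply: (sub_finite_set (B := \bigcup_(i in `I_(`|b - a|.+1)) slice (a + i%:Z))).
  by move=> x /= abx; exists `|level x - a|%N; rewrite /slice /=; lia.
by apply: bigcup_finite.
Qed.

(** Stated for arbitrary sets rather than finite ones, because the region beyond a wall may be
    infinite while its boundary is finite. *)
Definition boundary A : set E :=
  [set e | exists x y, [/\ adj x y, A x, ~ A y & e = [fset x; y]%fset]].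

Lemma edge_boundaryE (C : E) : edge_boundary C = boundary [set` C].
Proof.
by apply/seteqP; split=> e [x [y [xy xC yC ->]]]; exists x, y; split=> //; exact/negP.
Qed.

Lemma boundary_edges A : boundary A `<=` @edges G.
Proof. by move=> e [x [y [xy _ _ ->]]]; exists x, y. Qed.

Lemma connected_crossing A B x y : connected_on A -> A x -> A y -> B x -> ~ B y ->
  exists u v, [/\ adj u v, A u, A v, B u & ~ B v].
Proof.
move=> [_ /(_ x y)] + Ax Ay => /(_ Ax Ay) [p [+ <- {y Ay}]].
elim: p x Ax => [//|z p IHp] x Ax /= /andP[xz zp] pA Bx nB.
have Az : A z by apply: pA; rewrite mem_head.
have [Bz|nBz] := pselect (B z); last by exists x, z.
by apply: (IHp z) => // t tp; apply: pA; rewrite in_cons tp orbT.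
Qed.

Definition inner h (e : E) := [set` e] `<=` slice h.

(** * Good slices and uniqueness for fixed couplings *)

Section Spins.
Variable R : realType.
Implicit Types (J : E -> R) (s t : V -> R).

Lemma edge_spin s x y : adj x y ->
  \prod_(z <- [fset x; y]%fset) s z = s x * s y.
Proof.
move=> xy; rewrite big_fsetU1 ?big_seq_fset1// inE.
by apply: contraTN xy => /eqP ->; rewrite adj_irr.
Qed.

Lemma edge_spin_norm s (e : E) : spin_configuration s ->
  `|\prod_(z <- e) s z| = 1.
Proof.
move=> sp; rewrite normr_prod big1// => x _.
by case: (sp x) => ->; rewrite ?normrN normr1.
Qed.

Variable N : nat.

(* [N] bonds below the margin add up to less than [1 / n.+1]. *)
Definition margin n : R := (N.+1%:R)^-1 * (n.+1%:R)^-1.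

Lemma margin_gt0 n : 0 < margin n.
Proof. by rewrite mulr_gt0// invr_gt0. Qed.

(** Both windows are nonempty open intervals, so a law of full support charges them. Prescribing one
    window per bond makes goodness of a thin slice a cylinder event in the couplings. *)
Definition window h n (e : E) : set R :=
  if `[< inner h e >] then `]1, +oo[%classic else `](- margin n), (margin n)[%classic.

Definition good_slice J h n :=
  thin_slice G N h /\ forall e, edges_touching h e -> window h n e (J e).

Lemma good_slice_outer J h n : good_slice J h n ->
  forall e, edges_touching h e -> ~ inner h e -> `|J e| < margin n.
Proof.
move=> [_ gJ] e eh ne; have := gJ e eh.
by rewrite /window asboolF//= in_itv/= ltr_norml.
Qed.

Lemma outer_sum J s h n (X : set E) : good_slice J h n -> spin_configuration s ->
  X `<=` edges_touching h -> (forall e, X e -> ~ inner h e) ->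
  \sum_(e \in X) (J e * \prod_(z <- e) s z) <= (n.+1%:R)^-1.
Proof.
move=> gJ sp Xh Xo; have [th _] := gJ.
have XN : (X #<= `I_N)%card.
  by apply: card_le_trans th; exact: subset_card_le.
have finX : finite_set X by apply: card_le_finite XN _; exact: finite_II.
rewrite fsbig_finite//=; apply: (@le_trans _ _ (\sum_(e <- fset_set X) margin n)).
  rewrite big_seq [leRHS]big_seq; apply: ler_sum => e.
  rewrite in_fset_set// inE => Xe; apply: le_trans (ler_norm _) _.
  rewrite normrM edge_spin_norm// mulr1 ltW//.
  by apply: good_slice_outer gJ _ _ _; [exact: Xh|exact: Xo].
rewrite big_const_seq count_predT iter_addr_0 -[margin n *+ _]mulr_natl /margin mulrA.
rewrite ler_piMl ?invr_ge0// ler_pdivrMr// mul1r ler_nat.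
by apply: leqW; rewrite geq_card_fset_set.
Qed.

Lemma ground_stateP J s (C : E) : ground_state J s ->
  0 <= \sum_(e \in edge_boundary C) (J e * \prod_(z <- e) s z).
Proof. by move=> [_ /(_ C)]; rewrite oppr_le0. Qed.

(* Otherwise flipping the plus spins of the slice would satisfy an inner bond at a
   gain that exceeds the cost of all the outer bonds. *)
Lemma good_slice_rigid J s h n : connected_on (@slice G h) ->
  good_slice J h n -> ground_state J s ->
  forall x y, slice h x -> slice h y -> s x = s y.
Proof.
move=> ch gJ gs; have [sp _] := gs.
suff H x y : slice h x -> slice h y -> s x = 1 -> s y = -1 -> False.
  move=> x y hx hy; case: (sp x) => sx; case: (sp y) => sy; rewrite sx sy//.
    by case: (H x y).
  by case: (H y x).
move=> hx hy sx sy.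
pose A := [set z : V | slice h z /\ s z = 1].
have n1 : (1 : R) <> -1 by lra.
have [u [v [uv hu hv su sv]]] :
    exists u v, [/\ adj u v, slice h u, slice h v, s u = 1 & s v <> 1].
  by apply: (connected_crossing (B := [set z | s z = 1]) ch hx hy); rewrite //= sy => /esym.
have finA : finite_set A.
  by apply: sub_finite_set (finite_levels h h) => z [<- _] /=; rewrite lexx.
have := ground_stateP (fset_set A) gs; rewrite edge_boundaryE fset_setK//.
have finB : finite_set (boundary A).
  by have := finite_edge_boundary (fset_set A); rewrite edge_boundaryE fset_setK.
have touchA : boundary A `<=` edges_touching h.
  move=> e eA; split; first exact: boundary_edges eA.
  by case: eA => a [b [_ [ha _] _ ->]]; exists a; rewrite ?inE ?eqxx.
have eA : boundary A [fset u; v]%fset.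
  by exists u, v; split=> //; case.
have ei : inner h [fset u; v]%fset by move=> z /=; rewrite !inE => /orP[]/eqP ->.
rewrite (fsbigID (inner h))//=.
(* This single bond is singled out because its term is below -1, whereas all outer terms together
   give at most [1 / n.+1 <= 1]. *)
rewrite (fsbigD1 [fset u; v]%fset)//=; last exact: finite_setIl.
have inner_lt e : boundary A e -> inner h e -> J e * \prod_(z <- e) s z < -1.
  move=> Ae ie; have := gJ.2 e (touchA _ Ae).
  rewrite /window asboolT//= in_itv/= andbT => J1.
  case: Ae ie J1 => a [b [ab [ha sa] nb ->]] ie J1.
  rewrite edge_spin// sa.
  have -> : s b = -1.
    case: (sp b) => // sb; case: nb; split=> //.
    by apply: ie; rewrite /= !inE eqxx orbT.
  by rewrite mul1r mulrN1 ltrN2.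
set S1 := (X in _ + X + _); set S2 := (X in _ + X).
have S1le : S1 <= 0.
  apply: fsumr_le0 => e; move=> [[Ae ie] _]; apply: le_trans (ltW (inner_lt e Ae ie)) _; lra.
have S2le : S2 <= (n.+1%:R)^-1.
  apply: outer_sum gJ sp _ _ => [e [/touchA]|e []]//.
have := inner_lt _ eA ei.
have : (n.+1%:R)^-1 <= 1 :> R by rewrite invf_le1// ler1n.
move: S1 S2 (J _ * _) (_^-1) S1le S2le => S1 S2 p q; lra.
Qed.

(* The set obtained from [A] by truncating at a good level has the same boundary
   up to arbitrarily weak bonds. *)
Lemma ground_state_boundary J s A (a b : int) : ground_state J s ->
  A `<=` [set x | a <= level x] ->
  (forall x y, adj x y -> A x -> ~ A y -> level x <= b) ->
  (forall n, exists2 h, b <= h & good_slice J h n) ->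
  finite_set (boundary A) /\ 0 <= \sum_(e \in boundary A) (J e * \prod_(z <- e) s z).
Proof.
move=> gs Aa Ab ex; have [sp _] := gs.
pose C h := A `&` [set x : V | a <= level x <= h].
have finC h : finite_set (C h) by apply: finite_setIr; exact: finite_levels.
have finB h : finite_set (boundary (C h)).
  by have := finite_edge_boundary (fset_set (C h)); rewrite edge_boundaryE fset_setK.
have AC h : b <= h -> boundary A `<=` boundary (C h).
  move=> bh e [x [y [xy Ax Ay ->]]]; exists x, y; split=> //; last by case.
  by split=> //=; rewrite (le_trans (Ab _ _ xy Ax Ay) bh) andbT; exact: Aa.
have [h0 bh0 _] := ex 0%N.
split; first exact: sub_finite_set (AC _ bh0) (finB h0).
apply/ler_addgt0Pr => e e0.
have [n ne] : exists n, (n.+1%:R)^-1 < e :> R.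
  have [n n1] := ltr_add_invr e0; exists n; rewrite add0r in n1; exact: n1.
have [h bh gh] := ex n.
have := ground_stateP (fset_set (C h)) gs; rewrite edge_boundaryE fset_setK//.
rewrite (fsbigID (boundary A))//= setIC (setIidl (AC h bh)) => /le_trans; apply.
rewrite lerD2l; apply: le_trans (ltW ne).
(* Bonds created by the truncation join two vertices of [A], from level [h] upwards; hence they are
   outer bonds of the good slice [h]. *)
have cross f : boundary (C h) f -> ~ boundary A f ->
    exists x y, [/\ adj x y, level x = h, h < level y & f = [fset x; y]%fset].
  move=> [x [y [xy [Ax /= /andP[_ xh]] Cy ->]]] nA; exists x, y.
  have Ay : A y by apply: contrapT => nAy; apply: nA; exists x, y.
  have yh : h < level y.
    by rewrite ltNge; apply/negP => yh; apply: Cy; split=> //=; rewrite yh andbT; exact: Aa.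
  by split=> //; have := adj_level_le xy; lia.
apply: outer_sum gh sp _ _ => f [Cf /(cross f Cf)[x [y [xy xh yh fE]]]].
  by split; [exact: boundary_edges Cf|exists x; rewrite // fE !inE eqxx].
move=> /(_ y); rewrite fE /= !inE eqxx orbT => /(_ isT); rewrite /slice /=.
by move: yh => /[swap] ->; rewrite ltxx.
Qed.

(* The signs are encoded by the finite set [Y] of negated bonds, so that this is a
   countable conjunction. *)
Definition generic J := forall F Y : {fset E}, F != fset0 -> [set` F] `<=` @edges G ->
  \sum_(e <- F) (if e \in Y then - J e else J e) != 0.

Definition good_ends J := forall (k : int) n,
  (exists2 h, k <= h & good_slice J h n) /\ (exists2 h, h <= k & good_slice J h n).

(** The energy of the boundary is a signed sum of couplings, [Y] collecting the bonds with opposite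
    spins; genericity allows it to vanish only if it is empty. *)
Lemma generic_boundary J s A : generic J -> spin_configuration s ->
  finite_set (boundary A) ->
  \sum_(e \in boundary A) (J e * \prod_(z <- e) s z) = 0 -> boundary A = set0.
Proof.
move=> gJ sp finA; rewrite fsbig_finite//= => S0.
apply: contrapT => /eqP A0.
pose Y := [fset e in fset_set (boundary A) | \prod_(z <- e) s z == -1]%fset.
have : \sum_(e <- fset_set (boundary A)) (if e \in Y then - J e else J e) != 0.
  apply: gJ; last by rewrite fset_setK//; exact: boundary_edges.
  by apply: contra_neq A0; exact: fset_set_set0.
move/eqP; apply; rewrite -[RHS]S0; apply: eq_big_seq => e eA.
rewrite /Y !inE /= eA /=; case: eqP => [->|]; first by rewrite mulrN1.
move: eA; rewrite in_fset_set// inE => -[x [y [xy _ _ ->]]]; rewrite edge_spin//.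
by case: (sp x) (sp y) => -> [] ->; rewrite ?mulrN1 ?mul1r ?mulN1r ?opprK ?mulr1.
Qed.

Lemma boundary_eq0 A x y : connected_on [set: V] -> boundary A = set0 -> A x -> A y.
Proof.
move=> cG A0 Ax; apply: contrapT => nAy.
have [u [v [uv _ _ Au nAv]]] := connected_crossing cG (x := x) (y := y) I I Ax nAy.
by have : boundary A [fset u; v]%fset; [exists u, v|rewrite A0].
Qed.

(* The wall between [s] and [t] inside [h1, h2] is the boundary of a set
   reaching up to infinity (or of a finite one); its energies under [s] and [t]
   are opposite and both nonnegative. *)
Lemma ground_states_agree J s t (h1 h2 : int) n1 n2 :
  connected_on [set: V] -> (forall h, connected_on (@slice G h)) ->
  generic J -> good_ends J -> ground_state J s -> ground_state J t ->
  good_slice J h1 n1 -> good_slice J h2 n2 ->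
  (forall x, slice h1 x -> s x = t x) ->
  forall x, h1 <= level x <= h2 -> s x = t x.
Proof.
move=> cG cS genJ ends gs gt g1 g2 st1 x0 x0h.
have [[sp _] [tp _]] := (gs, gt).
have [h12|h21] := leP h1 h2; last by move: x0h; lia.
have [[w hw] _] := cS h2.
(* Both configurations are constant on slice [h2], so [w] tells whether they differ there. Above
   [h2] the set takes everything or nothing accordingly, so no bond is cut there. *)
pose A := [set x | (h1 <= level x <= h2 /\ s x <> t x) \/ (h2 < level x /\ s w <> t w)].
have Aw x : h2 <= level x -> A x <-> s w <> t w.
  rewrite le_eqVlt => /orP[/eqP xh|xh]; last first.
    by split=> [[[]|[]//]|]; [lia|right].
  have -> : s w = s x by apply: good_slice_rigid (cS h2) g2 gs _ _ hw _; rewrite /slice /= -xh.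
  have -> : t w = t x by apply: good_slice_rigid (cS h2) g2 gt _ _ hw _; rewrite /slice /= -xh.
  by split=> [[[]|[]]//|nst]; [rewrite xh ltxx|left; split=> //; lia].
have Ain x : h1 <= level x <= h2 -> A x <-> s x <> t x.
  by move=> xh; split=> [[[]|[]]//|nst]; [lia|left].
have Alow x : level x <= h1 -> ~ A x.
  move=> xh [[hx]|[]]; last by lia.
  by apply; apply: st1; rewrite /slice /=; lia.
have bdA x y : adj x y -> A x -> ~ A y -> h1 <= level x <= h2 /\ h1 <= level y <= h2.
  move=> xy Ax nAy; have xy1 := adj_level_le xy.
  rewrite adj_sym in xy; have yx1 := adj_level_le xy.
  have xh1 : h1 < level x by rewrite ltNge; apply/negP => /Alow.
  suff : level x <= h2 /\ level y <= h2 by lia.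
  have [xh|xh] := leP (level x) h2; have [yh|yh] := leP (level y) h2 => //.
  - by case: nAy; apply/Aw; [lia|apply/(Aw x) => //; lia].
  - by case: nAy; apply/Aw; [lia|apply/(Aw x) => //; lia].
  - by case: nAy; apply/Aw; [lia|apply/(Aw x) => //; lia].
have wall u : ground_state J u -> finite_set (boundary A) /\
    0 <= \sum_(e \in boundary A) (J e * \prod_(z <- e) u z).
  move=> gu; apply: (ground_state_boundary (a := h1) (b := h2)) gu _ _ _.
  - by move=> x Ax /=; rewrite leNgt; apply/negP => /ltW /Alow.
  - by move=> x y xy Ax nAy; have [/andP[]] := bdA _ _ xy Ax nAy.
  - by move=> n; have [] := ends h2 n.
have [finA s0] := wall s gs; have [_ t0] := wall t gt.
have opp : \sum_(e \in boundary A) (J e * \prod_(z <- e) t z) =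
    - \sum_(e \in boundary A) (J e * \prod_(z <- e) s z).
  rewrite -mulN1r mulr_fsumr; apply: eq_fsbigr => e.
  rewrite inE => -[x [y [xy Ax nAy ->]]]; rewrite !edge_spin//.
  have [hx hy] := bdA _ _ xy Ax nAy.
  have nx := (Ain x hx).1 Ax.
  have ny : s y = t y by apply: contrapT => /(Ain y hy).2.
  by move: nx; rewrite ny; case: (sp x) (tp x) => -> [] ->; lra.
have /(generic_boundary genJ sp finA) A0 : 
    \sum_(e \in boundary A) (J e * \prod_(z <- e) s z) = 0.
  by apply/eqP; rewrite eq_le s0 -oppr_ge0 -opp t0.
(* With an empty boundary, one point of [A] would force all of the connected graph into [A], but
   slice [h1] avoids it. *)
apply: contrapT => /(Ain x0 x0h).2 Ax0.
have [[z hz] _] := cS h1.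
by apply: (Alow z); [rewrite hz|exact: boundary_eq0 cG A0 Ax0].
Qed.

Lemma ground_state_unique J s t :
  connected_on [set: V] -> (forall h, connected_on (@slice G h)) ->
  generic J -> good_ends J -> ground_state J s -> ground_state J t ->
  t = s \/ t = \- s.
Proof.
move=> cG cS genJ ends gs gt.
have [sp _] := gs; have [tp _] := gt.
have tN : ground_state J (\- t).
  split=> [x|C]; first by case: (tp x) => /= ->; [right|left; rewrite opprK].
  have := gt.2 C; congr (- _ <= 0); apply: eq_fsbigr => e.
  by rewrite inE => -[x [y [xy _ _ ->]]]; rewrite !edge_spin//= mulrNN.
have [x0 _] := cG.1.
have key x y : s x = t x -> s y = t y.
  move=> stx; pose k := Order.min (level x) (level y).
  have [_ [h1 h1k g1]] := ends k 0%N.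
  have [[h2 kh2 g2] _] := ends (Order.max (level x) (level y)) 0%N.
  have [hx hy] : h1 <= level x <= h2 /\ h1 <= level y <= h2.
    by move: h1k kh2; rewrite /k le_min ge_max; lia.
  have [[z hz] _] := cS h1.
  have [stz|stz] := eqVneq (s z) (t z).
    apply: (ground_states_agree cG cS genJ ends gs gt g1 g2 _ hy) => a ha.
    by rewrite (good_slice_rigid (cS h1) g1 gs ha hz) stz;
       exact: good_slice_rigid (cS h1) g1 gt _ _ hz ha.
  (* On the rigid slice [h1] the configurations now differ everywhere, so [s] agrees there with the
     ground state [\- t]; carrying this to [x] contradicts [s x = t x]. *)
  have : s x = - t x.
    apply: (ground_states_agree cG cS genJ ends gs tN g1 g2 _ hx) => a ha.
    rewrite (good_slice_rigid (cS h1) g1 gs ha hz)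
      -(good_slice_rigid (cS h1) g1 tN hz ha) /=.
    by case: (sp z) (tp z) stz => -> [] ->; rewrite ?eqxx ?opprK.
  by rewrite stx; case: (tp x) => ->; lra.
have [e0|e0] := pselect (s x0 = t x0).
  by left; apply/funext => x; rewrite (key x0 x e0).
right; apply/funext => x /=.
have : s x <> t x by move=> /(key x x0).
by case: (sp x) (tp x) => -> [] ->; rewrite ?opprK.
Qed.
End Spins.
End Cylinder.

(** * Existence of ground states by compactness *)

Section Existence.
Variables (G : deformed_cylinder) (R : realType).
Local Notation V := (vertex G).
Local Notation E := {fset V}.
Implicit Types (J : E -> R) (C D L : {fset V}).

Let spin_of D (x : V) : R := if x \in D then 1 else -1.

(** Take a configuration of maximal [H], that is of minimal energy, among the finitely many whose
    plus spins lie in [L]. Flipping [C] reverses exactly the terms of its boundary bonds. *)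
Lemma finite_volume_ground_state J L : exists2 s : V -> R, spin_configuration s &
  forall C, (C `<=` L)%fset -> edge_boundary C `<=` [set e | (e `<=` L)%fset] ->
    0 <= \sum_(e \in edge_boundary C) (J e * \prod_(x <- e) s x).
Proof.
pose EL : set E := [set e | edges e /\ (e `<=` L)%fset].
have finEL : finite_set EL.
  apply: (sub_finite_set (B := [set` fpowerset L])) => // e [_ eL] /=.
  by rewrite fpowersetE.
pose H D := \sum_(e \in EL) (J e * \prod_(x <- e) spin_of D x).
have [D DL Dmax] : exists2 D, (D `<=` L)%fset & forall D', (D' `<=` L)%fset -> H D' <= H D.
  have P0 : fset0 \in fpowerset L by rewrite fpowersetE fsub0set.
  case: (@arg_maxP _ _ _ [` P0]%fset predT (fun D : fpowerset L => H (val D))) => // D _ Dmax.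
  exists (val D); first by rewrite -fpowersetE; exact: valP.
  move=> D'; rewrite -fpowersetE => D'L; exact: (Dmax [` D'L]%fset).
exists (spin_of D) => [x|C CL CbL]; first by rewrite /spin_of; case: ifP; [left|right].
(* The symmetric difference encodes the flip of all spins in [C]. *)
pose D' := ((D `\` C) `|` (C `\` D))%fset.
have sD' x : spin_of D' x = if x \in C then - spin_of D x else spin_of D x.
  by rewrite /spin_of !inE; case: (x \in C); case: (x \in D); rewrite ?opprK.
have D'L : (D' `<=` L)%fset.
  by rewrite fsubUset !(fsubset_trans (fsubsetDl _ _)).
have := Dmax _ D'L.
rewrite /H (fsbigID (edge_boundary C))// [leRHS](fsbigID (edge_boundary C))//=.
have -> : EL `&` edge_boundary C = edge_boundary C.
  rewrite setIidr// => e eC; split; last exact: CbL.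
  by case: eC => x [y [xy _ _ ->]]; exists x, y.
have -> : \sum_(e \in edge_boundary C) (J e * \prod_(x <- e) spin_of D' x) =
    - \sum_(e \in edge_boundary C) (J e * \prod_(x <- e) spin_of D x).
  rewrite -mulN1r mulr_fsumr; apply: eq_fsbigr => e.
  rewrite inE => -[x [y [xy xC /negbTE yC ->]]]; rewrite !edge_spin// !sD' xC yC.
  by rewrite mulN1r mulNr mulrN.
have -> : \sum_(e \in EL `&` ~` edge_boundary C) (J e * \prod_(x <- e) spin_of D' x) =
    \sum_(e \in EL `&` ~` edge_boundary C) (J e * \prod_(x <- e) spin_of D x).
  apply: eq_fsbigr => e; rewrite inE => -[[[x [y [xy ->]]] _] nC].
  rewrite !edge_spin// !sD'.
  case: ifPn => xC; case: ifPn => yC; rewrite ?mulrNN//.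
    by case: nC; exists x, y.
  by case: nC; exists y, x; split=> //; [rewrite adj_sym|rewrite fsetUC].
rewrite lerD2r; lra.
Qed.

Lemma ground_state_exists J : exists s : V -> R, ground_state J s.
Proof.
pose L n := fset_set [set x : V | - n%:Z <= level x <= n%:Z].
have inL x : \forall n \near \oo, x \in L n.
  exists `|level x|%N => // n /= xn.
  by rewrite in_fset_set ?inE /=; [lia|exact: finite_levels].
have near_all (F : set_system nat) (FF : Filter F) (A : {fset V}) (Q : V -> nat -> Prop) :
    (forall x, \forall n \near F, Q x n) -> \forall n \near F, forall x, x \in A -> Q x n.
  move=> FQ; have := filter_bigI (D := A) FF (fun x _ => FQ x).
  by apply: filterS => n + x xA; apply.
have /choice[t tP] : forall n, exists s : V -> R, spin_configuration s /\
  forall C, (C `<=` L n)%fset -> edge_boundary C `<=` [set e | (e `<=` L n)%fset] ->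
    0 <= \sum_(e \in edge_boundary C) (J e * \prod_(x <- e) s x).
  by move=> n; have [s] := finite_volume_ground_state J (L n); exists s.
(* The ultrafilter decides each spin, giving a pointwise limit; as it refines [\oo], each vertex
   lies in [L n] for [U]-almost all [n]. *)
have [U [UU ooU]] := ultraFilterLemma (F := \oo%classic) _.
pose s x : R := if `[< U [set n | t n x = 1] >] then 1 else -1.
have ts x : \forall n \near U, t n x = s x.
  rewrite /s; case: asboolP => // nU.
  have [//|] := in_ultra_setVsetC [set n | t n x = 1] UU.
  by apply: filterS => n /=; have [sp _] := tP n; case: (sp x).
exists s; split=> [x|C]; first by rewrite /s; case: asboolP; [left|right].
(* The inequality for [C] involves the spins on this finite set only, so a single [n] serves for all
   of them. *)
pose W := (C `|` [fset x | e in fset_set (edge_boundary C), x in (e : {fset V})])%fset.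
have finC := finite_edge_boundary C.
have : \forall n \near U, forall x, x \in W -> x \in L n /\ t n x = s x.
  by apply: near_all => x; apply: filterI; [exact: ooU (inL x)|exact: ts].
move=> /filter_ex[n nW]; have [_ /(_ C) tn] := tP n.
rewrite oppr_le0.
have eW e x : edge_boundary C e -> x \in e -> x \in W.
  move=> eC xe; rewrite /W inE; apply/orP; right.
  by apply/imfset2P; exists e; rewrite ?in_fset_set ?inE//; exists x.
have := tn _ _; rewrite (eq_fsbigr (fun e => J e * \prod_(z <- e) s z)); last first.
  move=> e; rewrite inE => eC; congr (_ * _); apply: eq_big_seq => x xe.
  by case: (nW x (eW e x eC xe)).
apply.
  by apply/fsubsetP => x xC; case: (nW x); rewrite // /W inE xC.
by move=> e eC; apply/fsubsetP => x xe; case: (nW x (eW e x eC xe)).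
Qed.

End Existence.

(** * Countable conjunctions and independence of pairs *)

Section Pairs.
Context d (T : measurableType d) (R : realType) (P : probability T R).

Lemma ae_forall_countable (C : countType) (Q : C -> T -> Prop) :
  (forall c, {ae P, forall w, Q c w}) -> {ae P, forall w, forall c, Q c w}.
Proof.
move=> aeQ; have : {ae P, forall w, forall n,
    if pickle_inv n is Some c then Q c w else True}.
  by apply: ae_foralln => n; case: pickle_inv => [c|]; [exact: aeQ|exact: aeW].
by apply: filterS => w Qw c; have := Qw (choice.pickle c); rewrite pickleK_inv.
Qed.

Context d1 d2 (T1 : measurableType d1) (T2 : measurableType d2).
Variables (X : {mfun T >-> T1}) (Y : {mfun T >-> T2}).

Let XY_measurable : measurable_fun [set: T] (fun w => (X w, Y w)).
Proof. by apply/measurable_fun_pair. Qed.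

Let XY : {mfun T >-> (T1 * T2)%type} := mfun_Sub (mem_set XY_measurable).

Local Open Scope ereal_scope.

(** As functions of [C] both sides are finite measures that agree on rectangles, a generating family
    stable under intersection. *)
Lemma indep_pair (Q : set T) : measurable Q ->
  (forall A B, measurable A -> measurable B ->
    P (Q `&` (X @^-1` A `&` Y @^-1` B)) = P Q * P (X @^-1` A `&` Y @^-1` B)) ->
  forall C : set (T1 * T2), measurable C ->
    P (Q `&` [set w | C (X w, Y w)]) = P Q * P [set w | C (X w, Y w)].
Proof.
move=> mQ QAB C mC.
have PQ : P Q \is a fin_num by exact: fin_num_measure.
have PQ0 : (0 <= fine (P Q))%R by exact: fine_ge0.
pose m1 : {measure set (T1 * T2)%type -> \bar R} := 
  pushforward (mrestr P mQ) XY.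
pose m2 : {measure set (T1 * T2)%type -> \bar R} := 
  mscale (NngNum PQ0) (distribution P XY).
have -> : P (Q `&` [set w | C (X w, Y w)]) = m1 (measurable_funP XY) C by rewrite setIC.
have -> : P Q * P [set w | C (X w, Y w)] = m2 C by rewrite -[in LHS](fineK PQ).
apply: (measure_unique [set A `*` B | A in measurable & B in measurable] (fun=> setT)) => //.
- exact: measurable_prod_measurableType.
- move=> _ _ [A mA [B mB <-]] [A' mA' [B' mB' <-]]; rewrite -setXI.
  by exists (A `&` A'); [exact: measurableI|exists (B `&` B'); [exact: measurableI|]].
- by move=> _; exists setT => //; exists setT => //; rewrite setXTT.
- by rewrite bigcup_const.
- move=> _ [A mA [B mB <-]]; rewrite /m1 /m2 /= /mscale /= fineK//.
  by rewrite /pushforward /mrestr setIC QAB.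
- move=> _; rewrite /m1 /= /pushforward /mrestr preimage_setT setTI.
  exact: le_lt_trans (probability_le1 P mQ) (ltry _).
Qed.

(** By independence the joint law is the product law, and Fubini integrates the null sections. *)
Lemma indep_pair_null (C : set (T1 * T2)) : 
  (forall A B, measurable A -> measurable B ->
    P (X @^-1` A `&` Y @^-1` B) = P (X @^-1` A) * P (Y @^-1` B)) ->
  measurable C -> (forall x, P (Y @^-1` xsection C x) = 0) ->
  P [set w | C (X w, Y w)] = 0.
Proof.
move=> AB mC C0.
rewrite -[LHS]/(distribution P XY C).
rewrite -(@product_measure_unique _ _ _ _ _ (distribution P X) (distribution P Y))//.
by rewrite /product_measure1 integral0_eq// => x _; exact: C0.
Qed.

End Pairs.

(** * Cylinder events and linear combinations of independent variables *)

Section Independence.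
Context d (T : measurableType d) (R : realType) (P : probability T R).
Variables (I : choiceType) (D : set I) (X : I -> {RV P >-> R}).
Hypothesis X_indep : mutually_independent D X.
Implicit Types (F : {fset I}) (B : I -> set R).
Local Open Scope ereal_scope.

Definition cylinder F B : set T := \bigcap_(i in [set` F]) (X i @^-1` B i).

Lemma measurable_cylinder F B : (forall i, measurable (B i)) -> measurable (cylinder F B).
Proof.
by move=> mB; apply: fin_bigcap_measurable => // i _; exact: measurable_funPTI.
Qed.

Lemma cylinderI F F' B B' : [disjoint F & F']%fset ->
  cylinder F B `&` cylinder F' B' =
  cylinder (F `|` F')%fset (fun i => if i \in F then B i else B' i).
Proof.
move=> /fdisjointP FF'; apply/seteqP; split=> w.
  move=> [wF wF'] i /=; rewrite inE; case: ifPn => [iF _|_ /= iF'].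
    exact: wF.
  exact: wF'.
move=> wFF'; split=> i /= iF; have := wFF' i; rewrite /= inE iF ?orbT => /(_ isT)//.
by case: ifPn => // /FF'; rewrite iF.
Qed.

Lemma cylinder_indep F F' B B' : [disjoint F & F']%fset ->
  [set` F] `<=` D -> [set` F'] `<=` D ->
  (forall i, measurable (B i)) -> (forall i, measurable (B' i)) ->
  P (cylinder F B `&` cylinder F' B') = P (cylinder F B) * P (cylinder F' B').
Proof.
move=> FF' FD F'D mB mB'; rewrite cylinderI// !X_indep//; first last.
- by move=> i; case: ifP.
- by move=> i /=; rewrite inE => /orP[/FD|/F'D].
have FF'_perm : perm_eq (F `|` F')%fset (F ++ F').
  apply: uniq_perm => //; last by move=> i; rewrite mem_cat inE.
  rewrite cat_uniq !fset_uniq /= andbT; apply/hasPn => i iF'.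
  by apply: contraL iF' => iF; move/fdisjointP : FF' => ->.
rewrite (perm_big _ FF'_perm) big_cat /=; congr (_ * _); apply: eq_big_seq => i iF; first by rewrite iF.
by case: ifPn => // jF; move/fdisjointP : FF' => /(_ i jF); rewrite iF.
Qed.

Lemma cylinder1 i (A : set R) : cylinder [fset i]%fset (fun=> A) = X i @^-1` A.
Proof.
apply/seteqP; split=> w; first by move=> /(_ i); rewrite /= inE eqxx; exact.
by move=> wA j /=; rewrite inE => /eqP ->.
Qed.

Lemma measurable_lincomb (a : I -> R) (l : seq I) :
  measurable_fun [set: T] (fun w => \sum_(i <- l) a i * X i w)%R.
Proof.
apply: measurable_sum => i; apply: measurable_funM => //; exact: measurable_funP.
Qed.

(** Induction on [l], with [F] general: the head variable is first absorbed into the cylinder, and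
    [indep_pair] then passes from the head and the tail sum to their combination. *)
Lemma lincomb_indep (a : I -> R) (l : seq I) F B : uniq l ->
  (forall i, i \in l -> D i /\ i \notin F) -> [set` F] `<=` D ->
  (forall i, measurable (B i)) -> forall C : set R, measurable C ->
  P (cylinder F B `&` [set w | C (\sum_(i <- l) a i * X i w)%R]) =
  P (cylinder F B) * P [set w | C (\sum_(i <- l) a i * X i w)%R].
Proof.
elim: l F B => [|j l IHl] F B /=.
  move=> _ _ FD mB C mC.
  have [C0|C0] := pselect (C 0%R).
    rewrite (_ : [set w | _] = setT) ?setIT ?probability_setT ?mule1//.
    by apply/seteqP; split=> // w _ /=; rewrite big_nil.
  rewrite (_ : [set w | _] = set0) ?setI0 ?measure0 ?mule0//.
  by apply/seteqP; split=> // w /=; rewrite big_nil.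
move=> /andP[jl ul] lDF FD mB C mC.
have [Dj jF] := lDF j (mem_head _ _).
pose Y : {mfun T >-> R} := mfun_Sub (mem_set (measurable_lincomb a l)).
have lD i : i \in l -> D i /\ i \notin F.
  by move=> il; apply: lDF; rewrite in_cons il orbT.
have mjF A : measurable A ->
   forall i, measurable (if i \in [fset j]%fset then A else B i).
  by move=> mA i; case: ifP.
have djF : [disjoint [fset j] & F]%fset by rewrite fdisjoint1X.
have D1 : [set` [fset j]%fset] `<=` D by move=> i /=; rewrite inE => /eqP ->.
(* The case [F' = F] splits off the cylinder; the case [F' = fset0], whose cylinder is the whole
   space, recognizes the remaining product as a joint probability. *)
have IH F' A A' : F' = F \/ F' = fset0 -> measurable A -> measurable A' ->
    P (cylinder F' B `&` (X j @^-1` A `&` Y @^-1` A')) =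
    P (cylinder F' B) * (P (X j @^-1` A) * P (Y @^-1` A')).
  move=> F'F mA mA'; rewrite setIA -(cylinder1 j A) [X in X `&` _]setIC cylinderI; last first.
    by case: F'F => -> //; exact: fdisjointX0.
  rewrite [LHS]IHl//; first last.
  - exact: mjF.
  - by move=> i /=; rewrite inE => /orP[/D1//|]; case: F'F => -> //; exact: FD.
  - move=> i il; have [Di iF] := lD i il; split=> //.
    rewrite !inE negb_or; apply/andP; split.
      by apply: contraNneq jl => <-.
    by case: F'F => ->.
  rewrite -cylinderI; last by case: F'F => -> //; exact: fdisjointX0.
  rewrite cylinder_indep//; last by case: F'F => -> //.
    by rewrite muleCA muleA.
  by case: F'F => -> //; exact: fdisjointX0.
have c0 : cylinder fset0 B = setT by apply/seteqP; split=> // w _ i /=; rewrite inE.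
have mf : measurable_fun [set: R * R] (fun z : R * R => a j * z.1 + z.2)%R.
  apply: measurable_funD => //; apply: measurable_funM => //.
under eq_set do rewrite big_cons.
apply: (indep_pair (X := X j) (Y := Y) (measurable_cylinder F mB) _
  (C := (fun z : R * R => a j * z.1 + z.2)%R @^-1` C)).
  move=> A A' mA mA'; rewrite (IH F)//; last by left.
  by have := IH fset0 A A' (or_intror erefl) mA mA'; rewrite c0 setTI probability_setT mul1e => ->.
by rewrite -[X in measurable X]setTI; exact: mf.
Qed.

(** Isolate one index [j]. Given the value [y] of the other terms, the sum vanishes only if [X j]
    equals [- y / a j], an event of probability zero. *)
Lemma lincomb_neq0 (a : I -> R) F : [set` F] `<=` D -> F != fset0 ->
  (forall i, a i != 0%R) -> (forall i x, D i -> P (X i @^-1` [set x]) = 0) ->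
  {ae P, forall w, (\sum_(i <- F) a i * X i w)%R != 0%R}.
Proof.
move=> FD /fset0Pn[j jF] a0 X0.
have Dj : D j := FD j jF.
pose l : seq I := (F `\ j)%fset.
pose Y : {mfun T >-> R} := mfun_Sub (mem_set (measurable_lincomb a l)).
have mf : measurable_fun [set: R * R] (fun z : R * R => a j * z.2 + z.1)%R.
  apply: measurable_funD => //; apply: measurable_funM => //.
have mC : measurable ((fun z : R * R => a j * z.2 + z.1)%R @^-1` [set 0%R]).
  by rewrite -[X in measurable X]setTI; exact: mf.
have Yj (A B : set R) : measurable A -> measurable B ->
    P (Y @^-1` A `&` X j @^-1` B) = P (Y @^-1` A) * P (X j @^-1` B).
  move=> mA mB; rewrite setIC muleC -(cylinder1 j B).
  apply: lincomb_indep => //; first exact: fset_uniq.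
    by move=> i; rewrite /l !inE => /andP[ij /FD].
  by move=> i /=; rewrite inE => /eqP ->.
have := indep_pair_null Yj mC; rewrite /= => H.
exists [set w | (\sum_(i <- F) a i * X i w)%R = 0%R]; split.
- rewrite -[X in measurable X]setTI; exact: (measurable_lincomb a F) (measurable_set1 _).
- rewrite -[RHS]H.
    by congr (P _); apply: eq_set => w; rewrite (big_fsetD1 j jF).
  move=> y; apply/eqP; rewrite eq_le measure_ge0 andbT -(X0 j (- y / a j)%R Dj).
  apply: le_measure; rewrite ?inE; [|exact: measurable_funPTI|].
    by apply: measurable_funPTI; exact: measurable_xsection.
  move=> w; rewrite /xsection /= inE /= => /eqP; rewrite addr_eq0 => /eqP <-.
  by rewrite mulrAC mulfV ?mul1r.
- by move=> w /= /negP; rewrite negbK => /eqP.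
Qed.

(** * Independent events of probability bounded below *)

Section SomeHit.
Variables (Fs : nat -> {fset I}) (Bs : nat -> I -> set R) (p : R).
Hypotheses (p_gt0 : (0 < p)%R) (FsD : forall j, [set` Fs j] `<=` D).
Hypothesis Fs_disj : forall i j, i <> j -> [disjoint Fs i & Fs j]%fset.
Hypothesis mBs : forall j i, measurable (Bs j i).
Hypothesis pFB : forall j, p%:E <= P (cylinder (Fs j) (Bs j)).

Let hit j := cylinder (Fs j) (Bs j).
Let miss m := \bigcap_(j in `I_m) ~` hit j.

Let measurable_hit j : measurable (hit j).
Proof. exact: measurable_cylinder. Qed.

Let measurable_miss m : measurable (miss m).
Proof. by apply: fin_bigcap_measurable => // j _; exact: measurableC. Qed.

(* The events [hit j] being independent, all of the first [m] of them fail with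
   probability [\prod_(j < m) (1 - P (hit j))]; only the bound on this product is
   kept. The induction needs independence from a further cylinder. *)
Let miss_indep m : exists2 c : R, (0 <= c <= (1 - p) ^+ m)%R &
  forall F B, [set` F] `<=` D -> (forall j, (j < m)%N -> [disjoint Fs j & F]%fset) ->
    (forall i, measurable (B i)) ->
    P (miss m `&` cylinder F B) = c%:E * P (cylinder F B).
Proof.
elim: m => [|m [c /andP[c0 cp] IHm]].
  exists 1%R; first by rewrite expr0 ler01 lexx.
  move=> F B _ _ _; rewrite mul1e (_ : miss 0 = setT) ?setTI//.
  by apply/seteqP; split.
have PE A : measurable A -> P A = (fine (P A))%:E.
  by move=> mA; rewrite fineK//; exact: fin_num_measure.
set q := fine (P (hit m)).
have pq : (p <= q)%R by rewrite -lee_fin -PE//; exact: pFB.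
have q1 : (q <= 1)%R by rewrite -lee_fin -PE//; exact: probability_le1.
exists (c * (1 - q))%R.
  rewrite mulr_ge0 ?subr_ge0//= exprSr ler_pM ?subr_ge0//.
  by rewrite lerD2l lerN2.
move=> F B FD FsF mB.
have mQ := measurable_cylinder F mB.
have -> : miss m.+1 `&` cylinder F B =
    (miss m `&` cylinder F B) `\` (miss m `&` (hit m `&` cylinder F B)).
  apply/seteqP; split=> w.
    move=> [wM wQ]; split; first by split=> // j jm; apply: wM; exact: ltnW.
    by move=> [_ [wh _]]; exact: (wM m (ltnSn m) wh).
  move=> [[wM wQ] nw]; split=> // j /=; rewrite ltnS leq_eqVlt => /orP[/eqP ->|].
    by move=> wh; apply: nw.
  exact: wM.
have -> : P ((miss m `&` cylinder F B) `\` (miss m `&` (hit m `&` cylinder F B))) =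
    P (miss m `&` cylinder F B) - P (miss m `&` (hit m `&` cylinder F B)).
  have mMQ : measurable (miss m `&` cylinder F B) by exact: measurableI.
  rewrite measureD//; last 2 first.
  - by apply: measurableI => //; exact: measurableI.
  - exact: le_lt_trans (probability_le1 P mMQ) (ltry _).
  by rewrite (setIidr (B := miss m `&` (hit m `&` cylinder F B)))// => w [wM []].
rewrite IHm//; last by move=> j jm; apply: FsF; exact: ltnW.
have mF : [disjoint Fs m & F]%fset by exact: FsF.
(* The hit and the further cylinder merge into one cylinder, to which the induction hypothesis
   applies. *)
rewrite {1}/hit cylinderI// IHm//; first last.
- by move=> i; case: ifP.
- move=> j jm; rewrite fdisjointXU Fs_disj ?FsF//; first exact: ltnW.
  by move=> jm'; rewrite jm' ltnn in jm.
- by move=> i /=; rewrite inE => /orP[/FsD|/FD].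
rewrite -cylinderI// cylinder_indep// -/(hit m) (PE (hit m))// (PE (cylinder F B))//.
by rewrite -!EFinM -EFinB; congr (_%:E); rewrite -/q; lra.
Qed.

(** Missing every cylinder has probability at most [(1 - p) ^+ m] for each [m], and this tends to
    0. *)
Lemma ae_some_cylinder : {ae P, forall w, exists j, cylinder (Fs j) (Bs j) w}.
Proof.
have mN : measurable (\bigcap_j ~` hit j).
  by apply: bigcapT_measurable => j; exact: measurableC.
exists (\bigcap_j ~` hit j); split=> //; last first.
  by move=> w /= /forallNP nw j _; exact: nw.
have PN : P (\bigcap_j ~` hit j) = (fine (P (\bigcap_j ~` hit j)))%:E.
  by rewrite fineK//; exact: fin_num_measure.
have p1 : (p <= 1)%R.
  by rewrite -lee_fin; exact: le_trans (pFB 0%N) (probability_le1 P (measurable_hit 0%N)).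
rewrite PN; congr (_%:E); apply/eqP; rewrite eq_le; apply/andP; split; last exact: fine_ge0.
have lim0 : ((1 - p) ^+ m)%R @[m --> \oo] --> (0 : R)%R.
  by apply: cvg_expr; rewrite ger0_norm ?subr_ge0// ltrBlDr ltrDl.
rewrite -(cvg_lim _ lim0)//; apply: limr_ge; first by apply/cvg_ex; exists 0%R.
near=> m; have [c /andP[_ cp] cE] := miss_indep m.
have := cE fset0 (fun=> setT) _ _ _; rewrite (_ : cylinder _ _ = setT); last first.
  by apply/seteqP; split=> // w _ i.
rewrite setIT probability_setT mule1 => missE.
apply: le_trans cp; rewrite -lee_fin -PN -missE//; last by move=> j _; exact: fdisjointX0.
by apply: le_measure; rewrite ?inE// => w wN j _; exact: wN.
Unshelve. all: by end_near. Qed.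

End SomeHit.

End Independence.

(** Greedy choice: the levels within distance 1 of those already chosen are finitely many, so [H]
    has another one. *)
Lemma infinite_separated (H : set int) : infinite_set H ->
  exists hs : nat -> int, (forall j, H (hs j)) /\
    forall i j, i <> j -> 1 < `|hs i - hs j|.
Proof.
move=> infH.
have /choice[g gP] : forall s : seq int, exists h,
    H h /\ forall h', h' \in s -> 1 < `|h - h'|.
  move=> s; apply: contrapT => nH; apply: infH.
  apply: (sub_finite_set (B := [set` flatten [seq [:: h' - 1; h'; h' + 1] | h' <- s]])).
    move=> h Hh /=; apply: contrapT => hs; apply: nH; exists h; split=> // h' h's.
    rewrite ltNge; apply/negP => hh'; apply: hs.
    apply/flatten_mapP; exists h' => //; rewrite !inE; move: hh'; lia.
  exact: finite_seq.
(* [L n] lists the first [n] choices, so [g (L n)] is separated from all of them. *)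
pose L := fix L n := if n is m.+1 then g (L m) :: L m else [::].
exists (fun n => g (L n)); split=> [j|]; first by case: (gP (L j)).
have L_mem i j : (i < j)%N -> g (L i) \in L j.
  elim: j => // j IHj; rewrite ltnS leq_eqVlt in_cons => /orP[/eqP ->|/IHj ->].
    by rewrite eqxx.
  by rewrite orbT.
move=> i j /eqP; rewrite neq_ltn => /orP[] /L_mem ij.
  by rewrite distrC; exact: (gP (L j)).2.
exact: (gP (L i)).2.
Qed.

Lemma le_expr_prod (R : realType) (I : eqType) (r : seq I) (f : I -> \bar R) (q : R) :
  0 <= q -> (forall i, i \in r -> (q%:E <= f i)%E) ->
  ((q ^+ size r)%:E <= \prod_(i <- r) f i)%E.
Proof.
move=> q0; elim: r => [|i r IHr] qf; first by rewrite big_nil expr0.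
rewrite big_cons /= exprS EFinM; apply: lee_pmul; rewrite ?lee_fin ?exprn_ge0//.
  by apply: qf; rewrite mem_head.
by apply: IHr => k kr; apply: qf; rewrite in_cons kr orbT.
Qed.

(** * Almost sure properties of the couplings *)

Section AlmostSure.
Variables (G : deformed_cylinder) (N : nat) (R : realType).
Variables (d : measure_display) (Omega : measurableType d) (P : probability Omega R).
Variables (mu : probability (measurableTypeR R) R) (J : {fset vertex G} -> {RV P >-> R}).
Hypothesis J_iid : iid (@edges G) J mu.

(** There are countably many pairs [F], [Y], and each signed sum is a linear combination with
    coefficients 1 and -1. *)
Lemma ae_generic : continuous_law mu ->
  {ae P, forall w, generic (G := G) (fun e => J e w)}.
Proof.
move=> mu_cont; apply: ae_forall_countable => F; apply: ae_forall_countable => Y.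
have [F0|F0] := pselect (F != fset0 /\ [set` F] `<=` @edges G); last first.
  by apply: aeW => w ? ?; case: F0.
have [indepJ lawJ] := J_iid.
pose a (e : {fset vertex G}) : R := if e \in Y then -1 else 1.
have := lincomb_neq0 (a := a) indepJ F0.2 F0.1.
have a0 e : a e != 0 by rewrite /a; case: ifP; rewrite ?oppr_eq0 oner_eq0.
have J0 e x : edges e -> P (J e @^-1` [set x]) = 0%E.
  by move=> eG; rewrite -(mu_cont x) -(lawJ e eG).
move=> /(_ a0 J0); apply: filterS => w aw _ _; move: aw.
congr (_ != 0); apply: eq_bigr => e _.
by rewrite /a; case: ifP; rewrite ?mulN1r ?mul1r.
Qed.

Lemma measurable_window h n (e : {fset vertex G}) :
  measurable (window (R := R) N h n e : set (measurableTypeR R)).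
Proof. by rewrite /window; case: ifP => _; exact: measurable_itv. Qed.

(** Only two windows occur for a given [n], so the smaller of their masses bounds all slices and
    bonds at once. *)
Lemma window_ge n : law_support mu = [set: R] -> exists2 q : R, 0 < q <= 1 &
  forall h (e : {fset vertex G}), (q%:E <= mu (window (R := R) N h n e))%E.
Proof.
move=> mu_supp.
have pos (U : set R) x : open U -> U x -> (0 < mu U)%E.
  move=> oU Ux; have : law_support mu x by rewrite mu_supp.
  by apply.
pose U1 : set R := `]1, +oo[%classic.
pose U2 : set R := `](- margin R N n), (margin R N n)[%classic.
have pos1 : (0 < mu U1)%E.
  by apply: (pos _ 2); [exact: interval_open|rewrite /U1 /= in_itv/= ltr1n].
have pos2 : (0 < mu U2)%E.
  apply: (pos _ 0); first exact: interval_open.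
  by rewrite /U2 /= in_itv/= oppr_lt0 margin_gt0.
have E (U : set R) : measurable U -> mu U = (fine (mu U))%:E.
  by move=> mU; rewrite fineK//; exact: fin_num_measure.
have mU1 : measurable U1 by exact: measurable_itv.
have E1 := E _ mU1; have E2 := E U2 (measurable_itv _).
exists (Num.min (fine (mu U1)) (fine (mu U2))).
  rewrite lt_min -!lte_fin -E1 -E2 pos1 pos2 /=.
  by rewrite ge_min -lee_fin -E1 probability_le1.
move=> h e; rewrite /window; case: ifP => _.
  by rewrite -/U1 E1 lee_fin ge_min lexx.
by rewrite -/U2 E2 lee_fin ge_min lexx orbT.
Qed.

Lemma edges_touching_disjoint (h h' : int) (e : {fset vertex G}) : 1 < `|h - h'| ->
  edges_touching h e -> ~ edges_touching h' e.
Proof.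
move=> hh' [[x [y [xy ->]]] [z ze hz]] [_ [z' ze' hz']].
move: hz hz'; rewrite /slice /= => hz hz'.
have xy1 := adj_level_le xy; rewrite adj_sym in xy; have yx1 := adj_level_le xy.
move: hh'; apply/negP; rewrite -leNgt ler_norml -hz -hz'.
by move: ze ze'; rewrite !inE => /orP[] /eqP -> /orP[] /eqP ->; lia.
Qed.

(** Bonds touching levels at distance at least 2 form disjoint families, so goodness of separated
    slices gives cylinders over disjoint index sets. *)
Lemma ae_good_slice (H : set int) n : law_support mu = [set: R] ->
  infinite_set H -> H `<=` thin_slice G N ->
  {ae P, forall w, exists2 h, H h & good_slice N (fun e => J e w) h n}.
Proof.
move=> mu_supp infH thinH; have [hs [Hhs sep]] := infinite_separated infH.
have [indepJ lawJ] := J_iid.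
have [q /andP[q0 q1] qle] := window_ge n mu_supp.
have finE j : finite_set (@edges_touching G (hs j)).
  by apply: card_le_finite (thinH _ (Hhs j)) _; exact: finite_II.
pose Fs j := fset_set (@edges_touching G (hs j)).
pose Bs j := window (R := R) N (hs j) n : {fset vertex G} -> set R.
have FsE j : [set` Fs j] `<=` @edges G by rewrite fset_setK// => e [].
have mBs j e : measurable (Bs j e) by exact: measurable_window.
have := @ae_some_cylinder _ _ _ P _ _ J indepJ Fs Bs (q ^+ N) _ FsE _ mBs _.
have qN : 0 < q ^+ N by rewrite exprn_gt0.
move=> /(_ qN).
have disj i j : i <> j -> [disjoint Fs i & Fs j]%fset.
  move=> ij; apply/fdisjointP => e; rewrite in_fset_set// inE => ei.
  by rewrite in_fset_set//; apply/negP; rewrite inE; exact: edges_touching_disjoint (sep i j ij) ei.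
move=> /(_ disj).
have PFB j : ((q ^+ N)%:E <= P (cylinder J (Fs j) (Bs j)))%E.
  (* As [q <= 1] and at most [N] bonds touch the slice, [q ^+ N] is a bound common to all slices. *)
  rewrite indepJ//; apply: (@le_trans _ _ (q ^+ size (Fs j))%:E).
    rewrite lee_fin ler_wiXn2l ?(ltW q0)//.
    by have := geq_card_fset_set (thinH _ (Hhs j)).
  apply: le_expr_prod; first exact: ltW.
  move=> e eF; rewrite -[X in (_ <= X)%E]/(distribution P (J e) (Bs j e)) lawJ//.
    exact: qle.
  exact: FsE eF.
move=> /(_ PFB); apply: filterS => w [j wj]; exists (hs j); first exact: Hhs.
split; first exact: thinH.
by move=> e eh; apply: wj; rewrite /= in_fset_set// inE.
Qed.

Lemma ae_good_ends : law_support mu = [set: R] ->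
  infinite_set [set h : int | 0 < h /\ thin_slice G N h] ->
  infinite_set [set h : int | h < 0 /\ thin_slice G N h] ->
  {ae P, forall w, good_ends N (G := G) (fun e => J e w)}.
Proof.
move=> mu_supp thin_pos thin_neg.
apply: ae_forall_countable => k; apply: ae_forall_countable => n.
(* Only finitely many positive levels lie below [k], so infinitely many thin ones remain. *)
have infU : infinite_set [set h | k <= h /\ thin_slice G N h].
  move=> fin; apply: thin_pos.
  apply: (sub_finite_set (B := [set h | k <= h /\ thin_slice G N h] `|` Posz @` `I_`|k|)).
    move=> h /= [h0 hN]; have [kh|hk] := leP k h; [by left|right].
    by exists `|h|%N => /=; lia.
  by rewrite finite_setU; split=> //; exact: finite_image.
have infL : infinite_set [set h | h <= k /\ thin_slice G N h].
  move=> fin; apply: thin_neg.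
  apply: (sub_finite_set
    (B := [set h | h <= k /\ thin_slice G N h] `|` (fun i : nat => - i%:Z) @` `I_`|k|)).
    move=> h /= [h0 hN]; have [kh|hk] := leP h k; [by left|right].
    by exists `|h|%N => /=; lia.
  by rewrite finite_setU; split=> //; exact: finite_image.
apply: filterS2 (ae_good_slice n mu_supp infU _) (ae_good_slice n mu_supp infL _).
- by move=> w [h [kh _] gh] [h' [hk' _] gh']; split; [exists h|exists h'].
- by move=> h [].
- by move=> h [].
Qed.

End AlmostSure.

Theorem theorem28 (G : deformed_cylinder)
    (G_connected : connected_on [set: vertex G])
    (slices_connected : forall h : int, connected_on (@slice G h))
    (N : nat)
    (thin_pos : infinite_set [set h : int | 0 < h /\ thin_slice G N h])
    (thin_neg : infinite_set [set h : int | h < 0 /\ thin_slice G N h])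
    (R : realType) (d : measure_display) (Omega : measurableType d)
    (P : probability Omega R)
    (mu : probability (measurableTypeR R) R)
    (mu_symmetric : symmetric_law mu)
    (mu_continuous : continuous_law mu)
    (mu_support : law_support mu = [set: R])
    (J : {fset vertex G} -> {RV P >-> R})
    (J_iid : iid (@edges G) J mu) :
  {ae P, forall w,
    exists! p : set (vertex G -> R), ground_state_pair (fun e => J e w) p}.
Proof.
apply: filterS2 (ae_generic J_iid mu_continuous)
  (ae_good_ends J_iid mu_support thin_pos thin_neg) => w genw endsw.
have [s gs] := ground_state_exists (fun e => J e w).
exists [set s; \- s]; split; first by exists s.
move=> _ [t gt ->].
(* For [t = \- s] the two members of the pair merely trade places. *)
have [->//|->] := ground_state_unique G_connected slices_connected genw endsw gs gt.
have -> : \- \- s = s by apply/funext => x; rewrite /= opprK.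
exact: setUC.
Qed.
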